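(* For every Inclusion Logic formula $\phi(\bar x)$ with free variables among $\bar x=(x_1,\ldots,x_n)$ there is a $\mathrm{PGFP}$-formula $\phi^*(R,\bar x)$, where $R$ is an $n$-ary relation symbol occurring only positively in $\phi^*$, such that for all models $M$ and all teams $X$ on $M$ with $\mathrm{dom}(X)=\{x_1,\ldots,x_n\}$: $$M\models_X\phi(\bar x)\iff (M,X(\bar x))\models_s\phi^*(R,\bar x)\text{ for all } s\in X.$$
   Context: A team $X$ over $M$ with domain $V$ is a set of assignments $s:V\to\mathrm{dom}(M)$; $\bar t\langle s\rangle$ is the value of the tuple of terms $\bar t$ under $s$, and $X(\bar t)=\{\bar t\langle s\rangle:s\in X\}$. $(M,P)$ is the expansion of $M$ interpreting $R$ by $P$. Inclusion Logic formulas are first-order formulas in negation normal form, built from first-order literals and inclusion atoms $\bar t_1\subseteq\bar t_2$ (with $|\bar t_1|=|\bar t_2|$) using $\wedge,\vee,\exists,\forall$, with (lax) team semantics: for a literal $\alpha$, $M\models_X\alpha$ iff $M\models_s\alpha$ (Tarskian) for all $s\in X$; $M\models_X\bar t_1\subseteq\bar t_2$ iff $X(\bar t_1)\subseteq X(\bar t_2)$; $M\models_X\phi\vee\psi$ iff $X=Y\cup Z$ with $M\models_Y\phi$ and $M\models_Z\psi$; $M\models_X\phi\wedge\psi$ iff both hold; $M\models_X\exists v\phi$ iff there is $H:X\to\mathcal P(\mathrm{dom}(M))\setminus\{\emptyset\}$ with $M\models_{X[H/v]}\phi$, where $X[H/v]=\{s[m/v]:s\in X,m\in H(s)\}$; $M\models_X\forall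 v\phi$ iff $M\models_{X[M/v]}\phi$, where $X[M/v]=\{s[m/v]:s\in X,m\in\mathrm{dom}(M)\}$. $\mathrm{PGFP}$ (Positive Greatest Fixed Point Logic) is first-order logic extended by the operator $[\mathrm{gfp}_{S,\bar y}\,\psi(S,\bar y)]\bar t$ ($S$ only positive in $\psi$, $\mathrm{ar}(S)=|\bar y|=|\bar t|$), true under $s$ iff $\bar t\langle s\rangle$ lies in the greatest fixed point of the operator $P\mapsto\{\bar a:(M,P)\models_{s[\bar a/\bar y]}\psi\}$, where gfp-operators occur only positively. *)

(* Defs.v *)
From mathcomp Require Import all_boot.
From mathcomp Require Import boolp classical_sets.

Set Implicit Arguments.
Unset Strict Implicit.
Unset Printing Implicit Defensive.

Local Open Scope classical_set_scope.

(* A k-tuple over T is a function 'I_k -> T. *)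

Record signature := Signature {
  fsym : Type;
  far : fsym -> nat;
  rsym : Type;
  rar : rsym -> nat }.

Definition var := nat.

Inductive term (sg : signature) : Type :=
| TVar of var
| TApp (f : fsym sg) of ('I_(far f) -> term sg).

Arguments TVar {sg}.

Inductive atom (sg : signature) : Type :=
| AEq of term sg & term sg
| ARel (r : rsym sg) of ('I_(rar r) -> term sg).

(* dom_pt only records that the domain is nonempty. *)
Record structure (sg : signature) := Structure {
  dom :> Type;
  dom_pt : dom;
  fint : forall f : fsym sg, ('I_(far f) -> dom) -> dom;
  rint : forall r : rsym sg, set ('I_(rar r) -> dom) }.

(* The expansion of sg by one k-ary relation symbol None; the symbols of sg
   become Some r. *)
Definition expand_sig (sg : signature) (k : nat) : signature :=
  @Signature (fsym sg) (@far sg) (option (rsym sg))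
    (fun o => if o is Some r then rar r else k).

(* (M, P) *)
Definition expand (sg : signature) (k : nat) (M : structure sg)
    (P : set ('I_k -> M)) : structure (expand_sig sg k) :=
  @Structure (expand_sig sg k) M (dom_pt M) (@fint sg M)
    (fun o => match o return set ('I_(@rar (expand_sig sg k) o) -> M) with
              | Some r => @rint sg M r
              | None => P
              end).

(* An assignment is a partial function on variables. *)
Definition assignment (T : Type) := var -> option T.

Definition adom (T : Type) (s : assignment T) : set var :=
  [set v | s v <> None].

(* s[m/v] *)
Definition upd (T : Type) (s : assignment T) (v : var) (m : T) : assignment T :=
  fun w => if w == v then Some m else s w.

(* s[a/y], meant for injective y *)
Definition upds (T : Type) (k : nat) (s : assignment T) (y : 'I_k -> var)
    (a : 'I_k -> T) : assignment T :=
  fun w => if [pick i | y i == w] is Some i then Some (a i) else s w.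

(* Variables outside the domain of s get the junk value dom_pt M. *)
Fixpoint tval (sg : signature) (M : structure sg) (s : assignment M)
    (t : term sg) : M :=
  match t with
  | TVar v => odflt (dom_pt M) (s v)
  | TApp f ts => fint (fun i => tval s (ts i))
  end.

Definition tvals (sg : signature) (M : structure sg) (k : nat)
    (t : 'I_k -> term sg) (s : assignment M) : 'I_k -> M :=
  fun i => tval s (t i).

Definition asat (sg : signature) (M : structure sg) (s : assignment M)
    (a : atom sg) : Prop :=
  match a with
  | AEq t1 t2 => tval s t1 = tval s t2
  | ARel r ts => @rint sg M r (tvals ts s)
  end.

Fixpoint tfv (sg : signature) (t : term sg) : set var :=
  match t with
  | TVar v => [set v]
  | TApp f ts => [set v | exists i, tfv (ts i) v]
  end.

Definition tsfv (sg : signature) (k : nat) (ts : 'I_k -> term sg) : set var :=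
  [set v | exists i, tfv (ts i) v].

Definition afv (sg : signature) (a : atom sg) : set var :=
  match a with
  | AEq t1 t2 => tfv t1 `|` tfv t2
  | ARel r ts => tsfv ts
  end.

Inductive incl (sg : signature) : Type :=
| IPos of atom sg
| INeg of atom sg
| IInc (k : nat) of ('I_k -> term sg) & ('I_k -> term sg)
| IAnd of incl sg & incl sg
| IOr of incl sg & incl sg
| IEx of var & incl sg
| IAll of var & incl sg.

Fixpoint ifv (sg : signature) (phi : incl sg) : set var :=
  match phi with
  | IPos a | INeg a => afv a
  | IInc _ t1 t2 => tsfv t1 `|` tsfv t2
  | IAnd f g | IOr f g => ifv f `|` ifv g
  | IEx v f | IAll v f => ifv f `\ v
  end.

Definition team (T : Type) := set (assignment T).

Definition team_dom (T : Type) (X : team T) (V : set var) : Prop :=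
  forall s, X s -> adom s = V.

(* X(t) *)
Definition tvalues (sg : signature) (M : structure sg) (X : team M) (k : nat)
    (t : 'I_k -> term sg) : set ('I_k -> M) :=
  [set tvals t s | s in X].

(* X[H/v] *)
Definition team_supp (T : Type) (X : team T) (H : assignment T -> set T)
    (v : var) : team T :=
  [set s' | exists s m, [/\ X s, H s m & s' = upd s v m]].

(* X[M/v] *)
Definition team_dup (T : Type) (X : team T) (v : var) : team T :=
  [set s' | exists s m, X s /\ s' = upd s v m].

Fixpoint isat (sg : signature) (M : structure sg) (X : team M)
    (phi : incl sg) : Prop :=
  match phi with
  | IPos a => forall s, X s -> asat s a
  | INeg a => forall s, X s -> ~ asat s a
  | IInc _ t1 t2 => tvalues X t1 `<=` tvalues X t2
  | IAnd f g => isat X f /\ isat X g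
  | IOr f g => exists Y Z : team M, [/\ X = Y `|` Z, isat Y f & isat Z g]
  | IEx v f => exists H : assignment M -> set M,
      (forall s, X s -> H s !=set0) /\ isat (team_supp X H v) f
  | IAll v f => isat (team_dup X v) f
  end.

(* First-order logic with gfp operators, before any positivity condition.
   GGfp y psi t is [gfp_{S,y} psi] t, where S is the symbol None of
   expand_sig sg k. *)
Inductive gform (sg : signature) : Type :=
| GAtom of atom sg
| GNot of gform sg
| GAnd of gform sg & gform sg
| GOr of gform sg & gform sg
| GEx of var & gform sg
| GAll of var & gform sg
| GGfp (k : nat) of ('I_k -> var) & gform (expand_sig sg k)
    & ('I_k -> term sg).

Fixpoint gfv (sg : signature) (phi : gform sg) : set var :=
  match phi with
  | GAtom a => afv a
  | GNot f => gfv f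
  | GAnd f g | GOr f g => gfv f `|` gfv g
  | GEx v f | GAll v f => gfv f `\ v
  | GGfp _ y f t => (gfv f `\` range y) `|` tsfv t
  end.

Definition is_greatest_fixpoint (T : Type) (F : set T -> set T) (P : set T) :=
  F P = P /\ forall Q, F Q = Q -> Q `<=` P.

Fixpoint gsat (sg : signature) (phi : gform sg) (M : structure sg)
    (s : assignment M) {struct phi} : Prop :=
  match phi with
  | GAtom a => asat s a
  | GNot f => ~ gsat f s
  | GAnd f g => gsat f s /\ gsat g s
  | GOr f g => gsat f s \/ gsat g s
  | GEx v f => exists m : M, gsat f (upd s v m)
  | GAll v f => forall m : M, gsat f (upd s v m)
  | GGfp k y f t => exists P : set ('I_k -> M),
      is_greatest_fixpoint
        (fun Q => [set a | @gsat _ f (expand Q) (upds s y a)]) P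
      /\ P (tvals t s)
  end.

Definition arel_in (sg : signature) (r : rsym sg) (a : atom sg) : Prop :=
  if a is ARel r' _ then r' = r else False.

(* Every occurrence of r is positive (b = true) resp. negative (b = false). *)
Fixpoint rel_polarity (b : bool) (sg : signature) (r : rsym sg)
    (phi : gform sg) {struct phi} : Prop :=
  match phi with
  | GAtom a => arel_in r a -> b
  | GNot f => rel_polarity (~~ b) r f
  | GAnd f g | GOr f g => rel_polarity b r f /\ rel_polarity b r g
  | GEx _ f | GAll _ f => rel_polarity b r f
  | GGfp k _ f _ => @rel_polarity b (expand_sig sg k) (Some r) f
  end.

Definition rel_positive (sg : signature) (r : rsym sg) (phi : gform sg) :=
  rel_polarity true r phi.

(* Every gfp operator occurs positively (b = true) resp. negatively
   (b = false). *)
Fixpoint gfp_polarity (b : bool) (sg : signature) (phi : gform sg) : Prop :=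
  match phi with
  | GAtom _ => True
  | GNot f => gfp_polarity (~~ b) f
  | GAnd f g | GOr f g => gfp_polarity b f /\ gfp_polarity b g
  | GEx _ f | GAll _ f => gfp_polarity b f
  | GGfp _ _ f _ => b /\ gfp_polarity b f
  end.

Fixpoint gfp_wf (sg : signature) (phi : gform sg) : Prop :=
  match phi with
  | GAtom _ => True
  | GNot f => gfp_wf f
  | GAnd f g | GOr f g => gfp_wf f /\ gfp_wf g
  | GEx _ f | GAll _ f => gfp_wf f
  | GGfp k y f _ =>
      [/\ injective y, @rel_positive (expand_sig sg k) None f & gfp_wf f]
  end.

Definition is_pgfp (sg : signature) (phi : gform sg) : Prop :=
  gfp_wf phi /\ gfp_polarity true phi.

(* Main.v *)
(** A subteam of a definable team is coded by a relation [S], so "the largest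
    subteam satisfying psi" is a greatest fixed point: it is the gfp of
    [S |-> {y | y lies in the big team /\ psi*(S, y)}].  Hence
    - a disjunction says that every assignment of the team lies in the largest
      subteam satisfying one of the two disjuncts;
    - [exists v psi] (resp. [forall v psi]) says that some (resp. every)
      [v]-variant of each assignment lies in the largest subteam of X[M/v]
      satisfying psi;
    - an inclusion atom is expressed by quantifying over the members of [R].
    Only the existence of the fixed points needs monotonicity, which follows
    from the positivity of [S]. *)

From mathcomp Require Import all_boot.
From mathcomp Require Import boolp classical_sets.
Require Import Defs.

Set Implicit Arguments.
Unset Strict Implicit.
Unset Printing Implicit Defensive.

Local Open Scope classical_set_scope.

(** * Greatest fixed points *)

(** The union of all post-fixed points, so that exhibiting one [Q] contained in [F Q] suffices for
    membership. *)
Definition sup_postfix (T : Type) (F : set T -> set T) : set T :=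
  [set a | exists2 Q, Q `<=` F Q & Q a].

(** Knaster-Tarski: by monotonicity the union is post-fixed, hence so is its image, which the union
    therefore contains. *)
Lemma sup_postfixP (T : Type) (F : set T -> set T) :
  (forall P Q, P `<=` Q -> F P `<=` F Q) ->
  is_greatest_fixpoint F (sup_postfix F).
Proof.
move=> F_mono; set G := sup_postfix F.
have sGF : G `<=` F G.
  move=> a [Q sQF Qa]; apply: (F_mono Q); last exact: sQF.
  by move=> b Qb; exists Q.
split; last by move=> Q FQ a Qa; exists Q; rewrite ?FQ.
by apply/seteqP; split=> // a FGa; exists (F G) => //; apply: F_mono.
Qed.

Lemma greatest_fixpoint_unique (T : Type) (F : set T -> set T) P Q :
  is_greatest_fixpoint F P -> is_greatest_fixpoint F Q -> P = Q.
Proof. by move=> [FP maxP] [FQ maxQ]; apply/seteqP; split; auto. Qed.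

(** * Monotonicity of satisfaction in a relation symbol *)

Section Rint.
Variables (sg : signature) (D : Type) (pt : D).
Variable fi : forall f : fsym sg, ('I_(far f) -> D) -> D.
Variables I1 I2 : forall r : rsym sg, set ('I_(rar r) -> D).

Lemma tval_rint (s : assignment D) t :
  @tval sg (Structure pt fi I1) s t = @tval sg (Structure pt fi I2) s t.
Proof. by elim: t => //= f ts IH; congr (fi _); apply: funext. Qed.

Lemma tvals_rint (s : assignment D) k (ts : 'I_k -> term sg) :
  @tvals sg (Structure pt fi I1) _ ts s = @tvals sg (Structure pt fi I2) _ ts s.
Proof. by apply: funext => i; apply: tval_rint. Qed.

End Rint.

(** Both polarities are treated at once because [GNot] swaps them. The statement is about arbitrary
    interpretations [I1], [I2], so that the induction hypothesis applies to the body of a gfp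
    operator, whose signature is larger. Well-formedness supplies the existence of the inner fixed
    points. *)
Lemma gsat_mono (sg : signature) (phi : gform sg) (D : Type) (pt : D)
    (fi : forall f : fsym sg, ('I_(far f) -> D) -> D)
    (I1 I2 : forall r : rsym sg, set ('I_(rar r) -> D)) (r : rsym sg)
    (b : bool) (s : assignment D) :
  gfp_wf phi -> rel_polarity b r phi ->
  (forall r', r' <> r -> I1 r' = I2 r') -> I1 r `<=` I2 r ->
  if b then @gsat _ phi (Structure pt fi I1) s ->
            @gsat _ phi (Structure pt fi I2) s
  else @gsat _ phi (Structure pt fi I2) s ->
       @gsat _ phi (Structure pt fi I1) s.
Proof.
move=> wf pol eqI leI.
elim: phi D pt fi I1 I2 r b s wf pol eqI leI => {sg}.
- move=> sg [t1 t2|r' ts] D pt fi I1 I2 r b s _ pol eqI leI /=.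
    by case: b {pol}; rewrite !(tval_rint pt fi I1 I2).
  rewrite (tvals_rint pt fi I1 I2); have [er|nr] := EM (r' = r).
    subst r'; move: pol => /= /(_ erefl) ->; exact: leI.
  by rewrite (eqI _ nr); case: b {pol}.
- move=> sg f IH D pt fi I1 I2 r b s /= wf pol eqI leI.
  have := IH D pt fi I1 I2 r (~~ b) s wf pol eqI leI.
  by case: b {pol} => /= H nf /H.
- move=> sg f IHf g IHg D pt fi I1 I2 r b s /= [wf wg] [pf pg] eqI leI.
  have := IHf D pt fi I1 I2 r b s wf pf eqI leI.
  have := IHg D pt fi I1 I2 r b s wg pg eqI leI.
  by case: b {pf pg} => /= H1 H2 [/H2 ? /H1 ?].
- move=> sg f IHf g IHg D pt fi I1 I2 r b s /= [wf wg] [pf pg] eqI leI.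
  have := IHf D pt fi I1 I2 r b s wf pf eqI leI.
  have := IHg D pt fi I1 I2 r b s wg pg eqI leI.
  by case: b {pf pg} => /= H1 H2 [/H2|/H1]; [left|right|left|right].
- move=> sg v f IH D pt fi I1 I2 r b s /= wf pol eqI leI.
  have := fun m => IH D pt fi I1 I2 r b (upd s v m) wf pol eqI leI.
  by case: b {pol} => /= H [m /H]; exists m.
- move=> sg v f IH D pt fi I1 I2 r b s /= wf pol eqI leI.
  have := fun m => IH D pt fi I1 I2 r b (upd s v m) wf pol eqI leI.
  by case: b {pol} => /= H fm m; apply: H.
move=> sg k y f IH t D pt fi I1 I2 r b s /= [_ posf wf] pol eqI leI.
pose F (I : forall r : rsym sg, set ('I_(rar r) -> D)) :=
  fun Q : set ('I_k -> D) =>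
    [set a | @gsat _ f (expand (M := Structure pt fi I) Q) (upds s y a)].
(* Here the bound symbol [None] varies and the interpretation is fixed. *)
have F_mono I P Q : P `<=` Q -> F I P `<=` F I Q.
  move=> sPQ a.
  apply: (IH D pt fi _ _ None true (upds s y a) wf posf) => //.
  by case.
(* Here [Some r] varies and the value of the bound symbol is fixed. *)
have F_le P a : if b then F I1 P a -> F I2 P a else F I2 P a -> F I1 P a.
  apply: (IH D pt fi _ _ (Some r) b (upds s y a) wf pol) => //.
  by case=> //= r' nr; apply: eqI => er; apply: nr; rewrite er.
rewrite (tvals_rint pt fi I1 I2); move: b F_le {pol} => [] F_le [P [gP Pt]].
(* By [F_le], a fixed point of one operator is post-fixed for the other, hence lies below its
   greatest fixed point. *)
- exists (sup_postfix (F I2)); split; first exact: (sup_postfixP (@F_mono I2)).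
  exists P => // a; rewrite -{1}gP.1; exact: F_le.
exists (sup_postfix (F I1)); split; first exact: (sup_postfixP (@F_mono I1)).
exists P => // a; rewrite -{1}gP.1; exact: F_le.
Qed.

Lemma gsat_expand_mono (sg : signature) (k : nat)
    (f : gform (expand_sig sg k)) (M : structure sg) (P Q : set ('I_k -> M))
    (s : assignment M) :
  gfp_wf f -> @rel_positive (expand_sig sg k) None f -> P `<=` Q ->
  @gsat _ f (expand P) s -> @gsat _ f (expand Q) s.
Proof.
move=> wf pos sPQ.
apply: (@gsat_mono _ f M (dom_pt M) (@fint sg M) _ _ None true s wf pos) => //.
by case.
Qed.

(** * Lifting along signature expansions *)

Fixpoint tlift (sg : signature) (k : nat) (t : term sg) :
    term (expand_sig sg k) :=
  match t with
  | TVar v => TVar v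
  | TApp f ts => @TApp (expand_sig sg k) f (fun i => tlift k (ts i))
  end.

Definition alift (sg : signature) (k : nat) (a : atom sg) :
    atom (expand_sig sg k) :=
  match a with
  | AEq t1 t2 => AEq (tlift k t1) (tlift k t2)
  | ARel r ts => @ARel (expand_sig sg k) (Some r) (fun i => tlift k (ts i))
  end.

Fixpoint ilift (sg : signature) (k : nat) (phi : incl sg) :
    incl (expand_sig sg k) :=
  match phi with
  | IPos a => IPos (alift k a)
  | INeg a => INeg (alift k a)
  | IInc _ t1 t2 => IInc (fun i => tlift k (t1 i)) (fun i => tlift k (t2 i))
  | IAnd f g => IAnd (ilift k f) (ilift k g)
  | IOr f g => IOr (ilift k f) (ilift k g)
  | IEx v f => IEx v (ilift k f)
  | IAll v f => IAll v (ilift k f)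
  end.

(** A translation copies the negated literals of its source, so positivity is claimed only for
    symbols that no [INeg] contains; after lifting, the new symbol [None] is always one. *)
Fixpoint ineg_free (sg : signature) (r : rsym sg) (phi : incl sg) : Prop :=
  match phi with
  | INeg a => ~ arel_in r a
  | IPos _ | IInc _ _ _ => True
  | IAnd f g | IOr f g => ineg_free r f /\ ineg_free r g
  | IEx _ f | IAll _ f => ineg_free r f
  end.

Fixpoint idepth (sg : signature) (phi : incl sg) : nat :=
  match phi with
  | IPos _ | INeg _ | IInc _ _ _ => 0
  | IAnd f g | IOr f g => (maxn (idepth f) (idepth g)).+1
  | IEx _ f | IAll _ f => (idepth f).+1
  end.

Section Lift.
Variables (sg : signature) (k : nat).

Lemma tval_lift (M : structure sg) (P : set ('I_k -> M)) (s : assignment M) t :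
  @tval _ (expand P) s (tlift k t) = tval s t.
Proof. by elim: t => //= f ts IH; congr fint; apply: funext. Qed.

Lemma tvals_lift (M : structure sg) (P : set ('I_k -> M)) j
    (ts : 'I_j -> term sg) (s : assignment M) :
  @tvals _ (expand P) _ (fun i => tlift k (ts i)) s = tvals ts s.
Proof. by apply: funext => i; apply: tval_lift. Qed.

Lemma asat_lift (M : structure sg) (P : set ('I_k -> M)) (s : assignment M) a :
  @asat _ (expand P) s (alift k a) = asat s a.
Proof.
by case: a => [t1 t2|r ts] /=; rewrite ?tval_lift //; rewrite tvals_lift.
Qed.

Lemma tvalues_lift (M : structure sg) (P : set ('I_k -> M)) (X : team M) j
    (ts : 'I_j -> term sg) :
  @tvalues _ (expand P) X _ (fun i => tlift k (ts i)) = tvalues X ts.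
Proof.
by apply/seteqP; split=> a [s Xs <-]; exists s; rewrite ?tvals_lift.
Qed.

Lemma isat_lift (M : structure sg) (P : set ('I_k -> M)) (X : team M) phi :
  @isat _ (expand P) X (ilift k phi) <-> isat X phi.
Proof.
elim: phi X => /=.
- by move=> a X; split=> H s /H; rewrite asat_lift.
- by move=> a X; split=> H s /H; rewrite asat_lift.
- by move=> j t1 t2 X; rewrite !tvalues_lift.
- by move=> f IHf g IHg X; rewrite IHf IHg.
- by move=> f IHf g IHg X; split=> -[Y [Z [XE /IHf ? /IHg ?]]]; exists Y, Z.
- by move=> v f IH X; split=> -[H [H0 /IH ?]]; exists H.
by move=> v f IH X; apply: IH.
Qed.

Lemma tfv_lift (t : term sg) : tfv (tlift k t) = tfv t.
Proof.
by elim: t => //= f ts IH; apply/seteqP; split=> v /= [i]; exists i;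
  rewrite ?IH // -IH.
Qed.

Lemma tsfv_lift j (ts : 'I_j -> term sg) :
  tsfv (fun i => tlift k (ts i)) = tsfv ts.
Proof.
by apply/seteqP; split=> v /= [i]; exists i; rewrite ?tfv_lift // -tfv_lift.
Qed.

Lemma afv_lift (a : atom sg) : afv (alift k a) = afv a.
Proof. by case: a => [t1 t2|r ts] /=; rewrite ?tfv_lift ?tsfv_lift. Qed.

Lemma ifv_lift (phi : incl sg) : ifv (ilift k phi) = ifv phi.
Proof.
elim: phi => //=.
- exact: afv_lift.
- exact: afv_lift.
- by move=> j t1 t2; rewrite !tsfv_lift.
- by move=> f -> g ->.
- by move=> f -> g ->.
- by move=> v f ->.
by move=> v f ->.
Qed.

Lemma idepth_lift (phi : incl sg) : idepth (ilift k phi) = idepth phi.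
Proof. by elim: phi => //= [f -> g ->|f -> g ->|v f ->|v f ->]. Qed.

Lemma ineg_free_lift (phi : incl sg) :
  @ineg_free (expand_sig sg k) None (ilift k phi).
Proof. by elim: phi => //= -[t1 t2|r ts] //=; discriminate. Qed.

Lemma ineg_free_liftS (phi : incl sg) (r : rsym sg) :
  ineg_free r phi -> @ineg_free (expand_sig sg k) (Some r) (ilift k phi).
Proof.
elim: phi => //=.
- by move=> [t1 t2|r' ts] //= nr [].
- by move=> f IHf g IHg [/IHf ? /IHg ?].
- by move=> f IHf g IHg [/IHf ? /IHg ?].
Qed.

End Lift.

(** * Formula combinators and assignments *)

(** The quantifier makes it closed, so an empty conjunction adds no free variable. *)
Definition gtrue (sg : signature) : gform sg :=
  GAll 0 (GAtom (AEq (TVar 0) (TVar 0))).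

Definition gexs (sg : signature) (l : seq var) (f : gform sg) : gform sg :=
  foldr (@GEx sg) f l.

Definition geqs (sg : signature) (k : nat) (t u : 'I_k -> term sg) : gform sg :=
  foldr (fun i => GAnd (GAtom (AEq (t i) (u i)))) (gtrue sg) (enum 'I_k).

Section Combinators.
Variable sg : signature.

(** A single final assignment [s'] stands for the chain of updates, so [l] may repeat variables, as
    [codom x] does for non-injective [x]. *)
Lemma gsat_exs (M : structure sg) l (f : gform sg) (s : assignment M) :
  gsat (gexs l f) s <->
  exists s', [/\ forall w, w \notin l -> s' w = s w,
                 forall w, w \in l -> s' w <> None & gsat f s'].
Proof.
elim: l s => [|v l IH] s /=.
  split=> [fs|[s' [es _ fs]]]; first by exists s.
  by rewrite (_ : s = s') //; apply: funext => w; rewrite es.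
split=> [[m /IH [s' [es ds fs]]]|[s' [es ds fs]]].
  exists s'; split=> // w; rewrite inE.
    by rewrite negb_or => /andP[/negPf nv /es ->]; rewrite /upd nv.
  have [wl _|nwl] := boolP (w \in l); first exact: ds.
  by rewrite orbF => wv; rewrite es // /upd wv.
case E: (s' v) => [m|]; last by case: (ds v); rewrite ?mem_head.
exists m; apply/IH; exists s'; split=> // w.
  move=> nwl; rewrite /upd; case: eqP => [->//|/eqP nv].
  by apply: es; rewrite inE negb_or nv.
by move=> wl; apply: ds; rewrite inE wl orbT.
Qed.

Lemma gfv_exs l (f : gform sg) :
  gfv (gexs l f) = gfv f `\` [set w | w \in l].
Proof.
elim: l => [|v l IH] /=.
  by apply/seteqP; split=> [w fw|w []//]; split.
rewrite IH; apply/seteqP; split=> w /=.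
  by move=> [[fw nl] nv]; split=> //; rewrite inE => /orP[/eqP|].
move=> [fw]; rewrite inE => nl; split; first split=> //.
  by move=> wl; apply: nl; rewrite wl orbT.
by move=> wv; apply: nl; rewrite wv eqxx.
Qed.

Lemma exs_wf l (f : gform sg) : gfp_wf f -> gfp_wf (gexs l f).
Proof. by elim: l. Qed.

Lemma exs_gfp_polarity b l (f : gform sg) :
  gfp_polarity b f -> gfp_polarity b (gexs l f).
Proof. by elim: l. Qed.

Lemma exs_rel_polarity b r l (f : gform sg) :
  rel_polarity b r f -> rel_polarity b r (gexs l f).
Proof. by elim: l. Qed.

Lemma gsat_eqs k (t u : 'I_k -> term sg) (M : structure sg)
    (s : assignment M) :
  gsat (geqs t u) s <-> tvals t s = tvals u s.
Proof.
rewrite /geqs; transitivity (forall i, i \in enum 'I_k ->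
    tvals t s i = tvals u s i); last first.
  split=> [H|-> //]; apply: funext => i; exact/H/mem_enum.
elim: (enum 'I_k) => [|i l IH] //=; rewrite IH; split.
  by move=> [ei H] j; rewrite inE => /orP[/eqP -> //|]; apply: H.
move=> H; split; first by apply: H; rewrite mem_head.
by move=> j jl; apply: H; rewrite inE jl orbT.
Qed.

Lemma gfv_eqs k (t u : 'I_k -> term sg) :
  gfv (geqs t u) `<=` tsfv t `|` tsfv u.
Proof.
rewrite /geqs; elim: (enum 'I_k) => [|i l IH] w /=; first by case=> -[].
by move=> [[tw|uw]|/IH //]; [left|right]; exists i.
Qed.

Lemma eqs_wf k (t u : 'I_k -> term sg) : gfp_wf (geqs t u).
Proof. by rewrite /geqs; elim: (enum 'I_k). Qed.

Lemma eqs_gfp_polarity b k (t u : 'I_k -> term sg) :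
  gfp_polarity b (geqs t u).
Proof. by rewrite /geqs; elim: (enum 'I_k). Qed.

Lemma eqs_rel_polarity b r k (t u : 'I_k -> term sg) :
  rel_polarity b r (geqs t u).
Proof. by rewrite /geqs; elim: (enum 'I_k) => [[]|i l IH]; split=> // -[]. Qed.

(** Only defaulted values are compared, since equality of value tuples tells no more about two
    assignments. *)
Lemma tval_eq (M : structure sg) (s s' : assignment M) (t : term sg) :
  (forall w, tfv t w -> odflt (dom_pt M) (s w) = odflt (dom_pt M) (s' w)) ->
  tval s t = tval s' t.
Proof.
elim: t => [v H|f ts IH H] /=; first exact: H.
by congr fint; apply: funext => i; apply: IH => w tw; apply: H; exists i.
Qed.

Lemma tvals_eq (M : structure sg) (s s' : assignment M) k
    (t : 'I_k -> term sg) :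
  (forall w, tsfv t w -> odflt (dom_pt M) (s w) = odflt (dom_pt M) (s' w)) ->
  tvals t s = tvals t s'.
Proof.
by move=> H; apply: funext => i; apply: tval_eq => w tw; apply: H; exists i.
Qed.

Lemma tsfv_var k (y : 'I_k -> var) : tsfv (fun i => @TVar sg (y i)) = range y.
Proof.
by apply/seteqP; split=> w [i]; [move=> ->|move=> _ <-]; exists i.
Qed.

(** Equal domains rule out confusing an undefined variable with one of value [dom_pt M]. *)
Lemma assignment_eq (M : structure sg) k (y : 'I_k -> var)
    (s s' : assignment M) :
  adom s = range y -> adom s' = range y ->
  tvals (fun i => @TVar sg (y i)) s = tvals (fun i => TVar (y i)) s' -> s = s'.
Proof.
move=> ds ds' e; apply: funext => w.
have [yw|nyw] := EM (range y w).
  have := yw; rewrite -{1}ds; have := yw; rewrite -{1}ds' /adom /=.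
  case: yw => i _ ew; have := congr1 (fun g => g i) e.
  by rewrite /tvals /= ew; case: (s w) (s' w) => [a|] [a'|] //= ->.
have := nyw; rewrite -{1}ds; have := nyw; rewrite -{1}ds' /adom /=.
by move=> /contrapT -> /contrapT ->.
Qed.

Lemma upds_dom (T : Type) k (y : 'I_k -> var) (s : assignment T) a :
  adom s = range y -> adom (upds s y a) = range y.
Proof.
move=> ds; apply/seteqP; split=> w; rewrite /adom /upds /=.
  case: pickP => [i /eqP <- _|_ sw]; first by exists i.
  by have : adom s w by []; rewrite ds.
by case=> i _ <-; case: pickP => // /(_ i); rewrite eqxx.
Qed.

Lemma tvals_upds (M : structure sg) k (y : 'I_k -> var) (s : assignment M) a :
  injective y -> tvals (fun i => @TVar sg (y i)) (upds s y a) = a.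
Proof.
move=> y_inj; apply: funext => i; rewrite /tvals /upds /=.
by case: pickP => [j /eqP /y_inj -> //|/(_ i)]; rewrite eqxx.
Qed.

(** Together with [tvals_upds], this makes tuples and assignments of domain [range y] correspond
    bijectively, which lets relations code teams. *)
Lemma upds_tvals (M : structure sg) k (y : 'I_k -> var) (s s' : assignment M) :
  injective y -> adom s = range y -> adom s' = range y ->
  upds s y (tvals (fun i => @TVar sg (y i)) s') = s'.
Proof.
move=> y_inj ds ds'; apply: (assignment_eq _ ds'); first exact: upds_dom.
exact: tvals_upds.
Qed.

Lemma upd_dom (T : Type) (s : assignment T) v m V :
  adom s = V -> adom (upd s v m) = V `|` [set v].
Proof.
move=> <-; apply/seteqP; split=> w; rewrite /adom /upd /=.
  by case: eqP => [->|_ ?]; [right|left].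
by case: eqP => // nv [].
Qed.

End Combinators.

(** A gfp operator must bind an injective tuple, while [x] may repeat variables. *)
Lemma enumerate_vars (l : seq var) :
  exists k (y : 'I_k -> var), injective y /\ range y = [set w | w \in l].
Proof.
exists (size (undup l)), (fun i => nth 0 (undup l) i); split.
  move=> i j /eqP; rewrite nth_uniq ?undup_uniq //; by move/eqP/val_inj.
apply/seteqP; split=> w /=.
  by case=> i _ <-; rewrite -mem_undup mem_nth.
rewrite -mem_undup => wl; have lt := wl; rewrite -index_mem in lt.
by exists (Ordinal lt) => //=; apply: nth_index.
Qed.

Lemma range_codom k (x : 'I_k -> var) : [set w | w \in codom x] = range x.
Proof.
apply/seteqP; split=> w /=; first by case/codomP=> i ->; exists i.
by case=> i _ <-; apply: codom_f.
Qed.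

Lemma enumerate_extension n (x : 'I_n -> var) (v : var) :
  exists k (y : 'I_k -> var), injective y /\ range y = range x `|` [set v].
Proof.
have [k [y [y_inj yE]]] := enumerate_vars (v :: codom x).
exists k, y; split=> //; rewrite yE -range_codom; apply/seteqP; split=> w /=.
  by rewrite inE => /orP[/eqP|]; [right|left].
by rewrite inE => -[->|->]; rewrite ?eqxx ?orbT.
Qed.

Lemma fresh_var (l : seq var) : exists N, forall w, w \in l -> w < N.
Proof.
exists (\max_(w <- l) w).+1 => w wl; rewrite ltnS.
exact: (@leq_bigmax_seq _ l xpredT id).
Qed.

(** * The translation *)

(* The symbol [R] names the team: [phistar] is only evaluated in models
   where [R] is interpreted by [X(x)]. *)
Definition translates (sg : signature) (R : rsym sg) (x : 'I_(rar R) -> var)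
    (phi : incl sg) (phistar : gform sg) : Prop :=
  [/\ is_pgfp phistar,
      forall r, ineg_free r phi -> rel_positive r phistar,
      gfv phistar `<=` range x &
      forall (M : structure sg) (X : team M),
        team_dom X (range x) ->
        tvalues X (fun i => TVar (x i)) = @rint sg M R ->
        (isat X phi <-> forall s, X s -> gsat phistar s)].

(* The gfp of a translation of [psi] defines the largest team satisfying
   [psi] inside the team defined by the constraint [C]. *)
Lemma gfp_largest_team (sg : signature) (k : nat) (y : 'I_k -> var)
    (psi : incl sg) (psis C : gform (expand_sig sg k))
    (M : structure sg) (C' : assignment M -> Prop) :
  injective y ->
  @translates (expand_sig sg k) None y (ilift k psi) psis ->
  (forall (Q : set ('I_k -> M)) s, adom s = range y ->
     (@gsat _ C (expand Q) s <-> C' s)) ->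
  exists Y : team M,
    [/\ team_dom Y (range y), isat Y psi, forall s, Y s -> C' s,
        forall Z : team M, team_dom Z (range y) -> isat Z psi ->
          (forall s, Z s -> C' s) -> Z `<=` Y &
        forall s, adom s = range y ->
          (gsat (GGfp y (GAnd C psis) (fun i => TVar (y i))) s <-> Y s)].
Proof.
move=> y_inj [[wf _] pos _ sem] CP.
(* Decodes a tuple into an assignment of domain [range y]; the base values [dom_pt M] are all
   overwritten. *)
pose asg := @upds M k (upds (fun=> None) y (fun=> dom_pt M)) y.
have d0 : adom (upds (fun=> None) y (fun=> dom_pt M)) = range y.
  apply/seteqP; split=> w; rewrite /adom /upds /=.
    by case: pickP => // i /eqP <- _; exists i.
  by case=> i _ <-; case: pickP => // /(_ i); rewrite eqxx.
have asg_dom a : adom (asg a) = range y by apply: upds_dom.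
pose yt := tvals (M := M) (fun i => @TVar sg (y i)).
have asgK s : adom s = range y -> asg (yt s) = s.
  by move=> ds; apply: upds_tvals.
have asgE s a : adom s = range y -> upds s y a = asg a.
  move=> ds; apply: (@assignment_eq sg M k y) => //; first exact: upds_dom.
  by rewrite !tvals_upds.
(* The operator of the formula, with [C] replaced by its meaning [C'], which is the same for every
   [Q]. *)
pose F (Q : set ('I_k -> M)) : set ('I_k -> M) :=
  [set a | C' (asg a) /\ @gsat _ psis (expand Q) (asg a)].
have F_mono P Q : P `<=` Q -> F P `<=` F Q.
  move=> sPQ a [Ca fa]; split=> //; apply: gsat_expand_mono sPQ fa => //.
  exact/pos/ineg_free_lift.
have GP := sup_postfixP F_mono; set G := sup_postfix F in GP.
have semQ (Z : team M) : team_dom Z (range y) ->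
    isat Z psi <->
    forall s, Z s -> @gsat _ psis (expand (tvalues Z (fun i => TVar (y i)))) s.
  move=> dZ; rewrite -(isat_lift (tvalues Z (fun i => TVar (y i)))).
  exact: sem.
pose Y : team M := [set s | adom s = range y /\ G (yt s)].
have YG : tvalues Y (fun i => @TVar sg (y i)) = G.
  apply/seteqP; split=> [a [s [_ Gs] <-] //|a Ga].
  by exists (asg a); rewrite ?tvals_upds //; split=> //; rewrite /yt tvals_upds.
have FY s : Y s -> F G (yt s) by case=> _; rewrite GP.1.
exists Y; split.
- by move=> s [].
- apply/semQ => [s []//|s Ys]; rewrite YG; case: (FY s Ys) => _.
  by rewrite asgK //; case: Ys.
- by move=> s Ys; case: (FY s Ys); rewrite asgK //; case: Ys.
- move=> Z dZ /(semQ _ dZ) fZ CZ s Zs; split; first exact: dZ.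
  (* By [semQ] and the constraint, the relation coding [Z] is a post-fixed point of [F]. *)
  exists (tvalues Z (fun i => TVar (y i))); last by exists s.
  move=> a [s' Zs' <-]; rewrite /F /= asgK ?dZ //; split; first exact: CZ.
  exact: fZ.
move=> s ds /=.
(* The assignment [s] drops out, since [upds] overwrites all of its domain [range y]. *)
have -> : (fun Q : set ('I_k -> M) =>
    [set a | @gsat _ C (expand Q) (upds s y a) /\
             @gsat _ psis (expand Q) (upds s y a)]) = F.
  apply: funext => Q; apply/seteqP; split=> a /=; rewrite asgE // => -[].
    by move=> /CP Ca fa; split=> //; apply: Ca.
  by move=> Ca fa; split=> //; apply/CP.
split=> [[P [gP Ps]]|[_ Gs]]; last by exists G.
by split=> //; rewrite -(greatest_fixpoint_unique gP GP).
Qed.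

(** Positivity in the bound symbol holds because a lifted formula never mentions [None]. *)
Lemma gfp_largest_team_pgfp (sg : signature) (k : nat) (y : 'I_k -> var)
    (psi : incl sg) (psis C : gform (expand_sig sg k)) :
  injective y ->
  @translates (expand_sig sg k) None y (ilift k psi) psis ->
  is_pgfp C -> (forall r, rel_positive r C) ->
  let f := GGfp y (GAnd C psis) (fun i => TVar (y i)) in
  [/\ is_pgfp f, forall r, ineg_free r psi -> rel_positive r f &
      gfv C `<=` range y -> gfv f `<=` range y].
Proof.
move=> y_inj [[wf gpol] pos fv _] [Cwf Cpol] Cpos f; split.
- split=> //=; split=> //; split; first exact: Cpos.
  exact/pos/ineg_free_lift.
- move=> r nr; split; first exact: Cpos.
  exact/pos/ineg_free_liftS.
- by move=> fvC w /= [[[/fvC|/fv] ? //]|]; rewrite tsfv_var.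
Qed.

(** Its value tuple determines an assignment of domain [range x], so the atom [R(x)] can express
    membership in the team. *)
Lemma team_mem (sg : signature) (M : structure sg) (X : team M) k
    (x : 'I_k -> var) s :
  team_dom X (range x) -> adom s = range x ->
  tvalues X (fun i => @TVar sg (x i)) (tvals (fun i => TVar (x i)) s) <-> X s.
Proof.
move=> dX ds; split=> [[s' Xs' /assignment_eq e]|Xs]; last by exists s.
by rewrite -(e (dX _ Xs') ds).
Qed.

(** * Translation of the single connectives *)

Section Cases.
Variables (sg : signature) (R : rsym sg) (x : 'I_(rar R) -> var).

Lemma translates_pos (a : atom sg) : afv a `<=` range x ->
  translates x (IPos a) (GAtom a).
Proof. by move=> fva; split=> // r _. Qed.

Lemma translates_neg (a : atom sg) : afv a `<=` range x ->
  translates x (INeg a) (GNot (GAtom a)).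
Proof. by move=> fva; split=> // r nr /nr. Qed.

Lemma translates_and (f g : incl sg) fs gs :
  translates x f fs -> translates x g gs ->
  translates x (IAnd f g) (GAnd fs gs).
Proof.
move=> [[wf pf] rf vf Sf] [[wg pg] rg vg Sg]; split=> //=.
- by move=> r [/rf ? /rg ?].
- by move=> w [/vf|/vg].
move=> M X dX XR; rewrite (Sf M X) // (Sg M X) //.
by split=> [[Hf Hg] s Xs|H]; [split; auto|split=> s /H []].
Qed.

(** The formula reads: some [u] equals [t1], and some [x] in [R] has [t2] equal to [u].
    Requantifying [x] destroys the value of [t1], so fresh variables [u] carry it. *)
Lemma translates_inc k (t1 t2 : 'I_k -> term sg) :
  tsfv t1 `|` tsfv t2 `<=` range x ->
  exists phis, translates x (IInc t1 t2) phis.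
Proof.
move=> fvt.
have fv1 : tsfv t1 `<=` range x by move=> w tw; apply: fvt; left.
have fv2 : tsfv t2 `<=` range x by move=> w tw; apply: fvt; right.
have [N NP] := fresh_var (codom x).
have {}NP w : range x w -> w < N by rewrite -range_codom => /NP.
pose u (j : 'I_k) : var := N + j.
have u_inj : injective u by move=> i j /addnI /val_inj.
have ux w : range x w -> w \notin codom u.
  by move=> /NP; apply: contraTN => /codomP[j ->]; rewrite -leqNgt leq_addr.
have xu j : u j \notin codom x.
  apply/negP => uj; have /ux : range x (u j) by rewrite -range_codom.
  by rewrite codom_f.
pose ut j := @TVar sg (u j).
pose f := GAnd (GAtom (ARel (fun i => TVar (x i)))) (geqs ut t2).
exists (gexs (codom u) (GAnd (geqs ut t1) (gexs (codom x) f))); split.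
- split.
    by apply/exs_wf; split; [|apply/exs_wf; split=> //]; apply: eqs_wf.
  apply/exs_gfp_polarity; split; [|apply/exs_gfp_polarity; split=> //];
    exact: eqs_gfp_polarity.
- move=> r _; apply/exs_rel_polarity; split; first exact: eqs_rel_polarity.
  apply/exs_rel_polarity; split=> //; exact: eqs_rel_polarity.
- rewrite gfv_exs /= gfv_exs !range_codom => w [] /= [/gfv_eqs|].
    by rewrite tsfv_var => -[] // /fv1.
  by case=> -[|/gfv_eqs []]; rewrite ?tsfv_var // => /fv2.
move=> M X dX XR.
have key s : X s ->
    (gsat (gexs (codom u) (GAnd (geqs ut t1) (gexs (codom x) f))) s <->
     tvalues X t2 (tvals t1 s)).
  move=> Xs; rewrite gsat_exs; split.
    move=> [s1 [e1 _ [/gsat_eqs E1 /gsat_exs[s2 [e2 _ /= []]]]]].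
    rewrite -XR => -[s' Xs' E'] /gsat_eqs E2; exists s' => //.
    have -> : tvals t1 s = tvals t1 s1.
      by apply: tvals_eq => w /fv1 /ux /e1 ->.
    have -> : tvals t2 s' = tvals t2 s2.
      apply: tvals_eq => w /fv2 [i _ <-].
      exact: (congr1 (fun g => g i) E').
    by rewrite -E1 -E2; apply: funext => j; rewrite /tvals /= e2.
  move=> [s' Xs' E].
  (* [s1] stores the value of [t1] in [u]; [s2] then gives the variables of [x] their values in the
     team member [s']. *)
  pose s1 := upds s u (tvals t1 s).
  pose s2 : assignment M := fun w => if w \in codom x then s' w else s1 w.
  have s1u : tvals ut s1 = tvals t1 s by apply: tvals_upds.
  have s1N w : w \notin codom u -> s1 w = s w.
    move=> nw; rewrite /s1 /upds; case: pickP => // j /eqP uj.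
    by rewrite -uj codom_f in nw.
  have s2x w : range x w -> s2 w = s' w.
    by rewrite -range_codom /s2 /= => ->.
  exists s1; split=> //.
    by move=> w /codomP[j ->]; rewrite /s1 /upds; case: pickP => // /(_ j);
      rewrite eqxx.
  split.
    apply/gsat_eqs; rewrite s1u; apply: tvals_eq => w /fv1 /ux /s1N ->.
    by [].
  apply/gsat_exs; exists s2; split.
  - by move=> w nw; rewrite /s2 (negPf nw).
  - move=> w wx; rewrite /s2 wx; have : range x w by rewrite -range_codom.
    by rewrite -(dX _ Xs').
  split=> /=.
    rewrite -XR; exists s' => //; apply: tvals_eq => w.
    by rewrite tsfv_var => /s2x ->.
  apply/gsat_eqs.
  have -> : tvals t2 s2 = tvals t2 s' by apply: tvals_eq => w /fv2 /s2x ->.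
  rewrite E -s1u; apply: funext => j.
  by rewrite /tvals /= /s2 (negPf (xu j)).
split=> [H s Xs|H a [s Xs <-]]; last by apply/(key s Xs)/H.
by apply/(key s Xs)/H; exists s.
Qed.

Lemma translates_or (f g : incl sg) k (y : 'I_k -> var) fs gs :
  injective y -> range y = range x ->
  @translates (expand_sig sg k) None y (ilift k f) fs ->
  @translates (expand_sig sg k) None y (ilift k g) gs ->
  exists phis, translates x (IOr f g) phis.
Proof.
move=> y_inj yx Tf Tg.
(* The atom [R(x)]: [Some R] names the whole team, [None] the subteam bound by the gfp. *)
pose C : gform (expand_sig sg k) :=
  GAtom (@ARel (expand_sig sg k) (Some R) (fun i => TVar (x i))).
have fvC : gfv C `<=` range y.
  by rewrite yx /C /= (@tsfv_var (expand_sig sg k)).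
have Cpgfp : is_pgfp C by [].
have Cpos r : rel_positive r C by [].
have [[wf pf] rf vf] := gfp_largest_team_pgfp y_inj Tf Cpgfp Cpos.
have [[wg pg] rg vg] := gfp_largest_team_pgfp y_inj Tg Cpgfp Cpos.
set fG := GGfp _ _ _ in wf pf rf vf.
set gG := GGfp _ _ _ in wg pg rg vg.
exists (GOr fG gG); split.
- by [].
- by move=> r [/rf ? /rg ?].
- by rewrite -yx => w [/(vf fvC)|/(vg fvC)].
move=> M X dX XR.
have CP (Q : set ('I_k -> M)) s : adom s = range y ->
    (@gsat _ C (expand Q) s <-> X s).
  by rewrite yx => ds; rewrite -(team_mem dX ds) XR.
have [Y [dY Yf YX Ymax Yg]] := gfp_largest_team y_inj Tf CP.
have [Z [dZ Zf ZX Zmax Zg]] := gfp_largest_team y_inj Tg CP.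
rewrite -/fG -/gG in Yg Zg.
rewrite -yx in dX.
split=> [[Y' [Z' [XE Y'f Z'g]]] s Xs|H].
  have Y'X t : Y' t -> X t by rewrite XE; left.
  have Z'X t : Z' t -> X t by rewrite XE; right.
  have := Xs; rewrite XE => -[Ys|Zs]; [left|right].
    apply/(Yg s (dX s Xs)).
    by apply: (Ymax Y') => // t /Y'X; apply: dX.
  apply/(Zg s (dX s Xs)).
  by apply: (Zmax Z') => // t /Z'X; apply: dX.
(* Both largest subteams stay inside [X] by the constraint, so they form the required split. *)
exists Y, Z; split=> //; apply/seteqP; split=> s; last by case; auto.
by move=> Xs; case: (H s Xs) => [/(Yg s (dX s Xs))|/(Zg s (dX s Xs))];
  [left|right].
Qed.

(* When [v] occurs in [x], the value it had in [X] is recovered by the fresh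
   bound variable [u]; otherwise [u] does not occur in the atom. *)
Lemma quantifier_constraint (v : var) k (y : 'I_k -> var) :
  range y = range x `|` [set v] ->
  exists C : gform (expand_sig sg k),
    [/\ is_pgfp C, forall r, rel_positive r C, gfv C `<=` range y &
        forall (M : structure sg) (X : team M),
          team_dom X (range x) ->
          tvalues X (fun i => TVar (x i)) = @rint sg M R ->
          forall (Q : set ('I_k -> M)) s, adom s = range y ->
            (@gsat _ C (expand Q) s <-> team_dup X v s)].
Proof.
move=> yE; have [u uP] := fresh_var (codom y).
have {}uP w : range y w -> w == u = false.
  by rewrite -range_codom => /uP /ltn_eqF.
pose z i := if x i == v then u else x i.
have xy i : range y (x i) by rewrite yE; left; exists i.
exists (GEx u (GAtom (@ARel (expand_sig sg k) (Some R) (fun i => TVar (z i))))).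
split=> //.
  move=> w /= [[i /= ->]]; rewrite /z; case: eqP => // _ _; exact: xy.
move=> M X dX XR Q s ds /=; rewrite -XR; split.
  move=> [m [s' Xs' E]].
  exists s', (odflt (dom_pt M) (s v)); split=> //.
  apply: (@assignment_eq sg M k y) => //.
    by rewrite yE; apply: upd_dom; apply: dX.
  apply: funext => j; rewrite /tvals /= /upd; case: eqP => [-> //|nv].
  have : range y (y j) by exists j.
  rewrite yE => -[[i _ ei]|//]; rewrite -ei.
  have := congr1 (fun g => g i) E; rewrite /tvals /= /z /upd ei.
  by rewrite (introF eqP nv) uP //; exists j.
move=> [s' [m [Xs' ->]]].
(* The bound [u] takes the value that the update at [v] erased. *)
exists (odflt (dom_pt M) (s' v)), s' => //.
apply: funext => i; rewrite /tvals /= /z /upd.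
case: (eqVneq (x i) v) => [->|/negPf nv]; first by rewrite eqxx.
by rewrite uP // nv.
Qed.

Lemma translates_ex v (f : incl sg) k (y : 'I_k -> var) fs :
  injective y -> range y = range x `|` [set v] ->
  @translates (expand_sig sg k) None y (ilift k f) fs ->
  exists phis, translates x (IEx v f) phis.
Proof.
move=> y_inj yE Tf.
have [C [Cpgfp Cpos fvC CP]] := quantifier_constraint yE.
have [[wf pf] rf vf] := gfp_largest_team_pgfp y_inj Tf Cpgfp Cpos.
set fG := GGfp _ _ _ in wf pf rf vf.
exists (GEx v fG); split=> //.
  by move=> w /= [/(vf fvC)]; rewrite yE => -[].
move=> M X dX XR.
have [Y [dY Yf YX Ymax Yg]] := gfp_largest_team y_inj Tf (CP M X dX XR).
rewrite -/fG in Yg.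
have dU s m : X s -> adom (upd s v m) = range y.
  by move=> /dX ds; rewrite yE; apply: upd_dom.
split=> [[H [H0 Hf]] s Xs|H].
  have [m Hm] := H0 s Xs; exists m; apply/(Yg _ (dU _ _ Xs)).
  (* The team [X[H/v]] lies in [X[M/v]] and satisfies [f], so the largest such team [Y] contains
     it. *)
  apply: (Ymax (team_supp X H v)) => //.
  - by move=> _ [s' [m' [Xs' _ ->]]]; apply: dU.
  - by move=> _ [s' [m' [Xs' _ ->]]]; exists s', m'.
  - by exists s, m.
(* Every value that keeps the variant in [Y] is chosen; as [Y] consists of [v]-variants of members
   of [X], this choice yields exactly [Y]. *)
exists (fun s => [set m | Y (upd s v m)]); split.
  by move=> s Xs; have [m /(Yg _ (dU _ _ Xs)) Ym] := H s Xs; exists m.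
rewrite (_ : team_supp _ _ _ = Y) //; apply/seteqP; split.
  by move=> _ [s [m [_ Ym ->]]].
move=> s Ys; have [s' [m [Xs' e]]] := YX s Ys.
by exists s', m; split=> //=; rewrite -e.
Qed.

Lemma translates_all v (f : incl sg) k (y : 'I_k -> var) fs :
  injective y -> range y = range x `|` [set v] ->
  @translates (expand_sig sg k) None y (ilift k f) fs ->
  exists phis, translates x (IAll v f) phis.
Proof.
move=> y_inj yE Tf.
have [C [Cpgfp Cpos fvC CP]] := quantifier_constraint yE.
have [[wf pf] rf vf] := gfp_largest_team_pgfp y_inj Tf Cpgfp Cpos.
set fG := GGfp _ _ _ in wf pf rf vf.
exists (GAll v fG); split=> //.
  by move=> w /= [/(vf fvC)]; rewrite yE => -[].
move=> M X dX XR.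
have [Y [dY Yf YX Ymax Yg]] := gfp_largest_team y_inj Tf (CP M X dX XR).
rewrite -/fG in Yg.
have dU s m : X s -> adom (upd s v m) = range y.
  by move=> /dX ds; rewrite yE; apply: upd_dom.
split=> [/= Hf s Xs m|H] /=.
  apply/(Yg _ (dU _ _ Xs)); apply: (Ymax (team_dup X v)) => //.
    by move=> _ [s' [m' [Xs' ->]]]; apply: dU.
  by exists s, m.
(* The formula puts [X[M/v]] inside [Y]; the constraint gives the converse. *)
rewrite (_ : team_dup _ _ = Y) //; apply/seteqP; split; last exact: YX.
by move=> _ [s [m [Xs ->]]]; apply/(Yg _ (dU _ _ Xs))/H.
Qed.

End Cases.

(* The subformulas are translated over an expanded signature, hence the
   induction on the depth instead of the structure. *)
Lemma translation_exists (sg : signature) (R : rsym sg) (x : 'I_(rar R) -> var)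
    (phi : incl sg) :
  ifv phi `<=` range x -> exists phis, translates x phi phis.
Proof.
have [n] := ubnP (idepth phi).
elim: n sg R x phi => // n IH sg R x [a|a|k t1 t2|f g|f g|v f|v f];
  rewrite /= ltnS => le_n fv.
- by exists (GAtom a); apply: translates_pos.
- by exists (GNot (GAtom a)); apply: translates_neg.
- exact: translates_inc.
- have [ltf ltg] : idepth f < n /\ idepth g < n.
    by split; apply: leq_ltn_trans le_n; [apply: leq_maxl|apply: leq_maxr].
  have [|fs Tf] := IH sg R x f ltf; first by move=> w fw; apply: fv; left.
  have [|gs Tg] := IH sg R x g ltg; first by move=> w gw; apply: fv; right.
  by exists (GAnd fs gs); apply: translates_and.
- have [ltf ltg] : idepth f < n /\ idepth g < n.
    by split; apply: leq_ltn_trans le_n; [apply: leq_maxl|apply: leq_maxr].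
  have [k [y [y_inj yE]]] := enumerate_vars (codom x).
  rewrite range_codom in yE.
  have [||fs Tf] := IH (expand_sig sg k) None y (ilift k f).
  + by rewrite idepth_lift.
  + by rewrite ifv_lift yE => w fw; apply: fv; left.
  have [||gs Tg] := IH (expand_sig sg k) None y (ilift k g).
  + by rewrite idepth_lift.
  + by rewrite ifv_lift yE => w gw; apply: fv; right.
  exact: translates_or y_inj yE Tf Tg.
- have [k [y [y_inj yE]]] := enumerate_extension x v.
  have [||fs Tf] := IH (expand_sig sg k) None y (ilift k f).
  + by rewrite idepth_lift.
  + rewrite ifv_lift yE => w fw.
    by have [->|nv] := eqVneq w v; [right|left; apply: fv; split=> //; apply/eqP].
  exact: translates_ex y_inj yE Tf.
- have [k [y [y_inj yE]]] := enumerate_extension x v.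
  have [||fs Tf] := IH (expand_sig sg k) None y (ilift k f).
  + by rewrite idepth_lift.
  + rewrite ifv_lift yE => w fw.
    by have [->|nv] := eqVneq w v; [right|left; apply: fv; split=> //; apply/eqP].
  exact: translates_all y_inj yE Tf.
Qed.

Theorem theorem15 (sg : signature) (n : nat) (x : 'I_n -> var)
    (phi : incl sg) (phi_fv : ifv phi `<=` range x) :
  exists phistar : gform (expand_sig sg n),
    [/\ is_pgfp phistar,
        @rel_positive (expand_sig sg n) None phistar,
        gfv phistar `<=` range x &
        forall (M : structure sg) (X : team M),
          team_dom X (range x) ->
          (isat X phi <->
           forall s : assignment M, X s ->
             @gsat (expand_sig sg n) phistar
               (expand (tvalues X (fun i => TVar (x i)))) s)].
Proof.
(* Lifting first makes the team symbol [None] absent from the source formula, which gives positivity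
   in it. *)
have [|phis [pg pos fv sem]] :=
  @translation_exists (expand_sig sg n) None x (ilift n phi).
  by rewrite ifv_lift.
exists phis; split=> //; first exact/pos/ineg_free_lift.
move=> M X dX; rewrite -(isat_lift (tvalues X (fun i => TVar (x i)))).
exact: sem.
Qed.
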